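(* The following two assertions (A) and (B) are equivalent. (A) There exist a positive integer $k$ and a universal constant $L\ge 1$ such that, for every $p\in(0,1)$, every finite set $X$, and every nontrivial decreasing family $\mathcal D\subseteq 2^X$, if $\mu_p(\mathcal D)\ge 1-\frac{1}{2k}$ then $\mathcal D^{(k)}$ is $(p/L)$-small. (B) There exist an integer $k\ge 2$ and a universal constant $L\ge 1$ such that, for every finite set $X$ and every nontrivial increasing family $\mathcal I\subseteq 2^X$, $p_k(\mathcal I)\le L\,q(\mathcal I)$.
   Context: For a finite set $X$ and $p\in[0,1]$, $\mu_p$ is the product measure on $2^X$: $\mu_p(\{A\})=p^{|A|}(1-p)^{|X\setminus A|}$ for $A\subseteq X$, and $\mu_p(\mathcal A)=\sum_{A\in\mathcal A}\mu_p(\{A\})$ for $\mathcal A\subseteq 2^X$. A family $\mathcal F\subseteq 2^X$ is nontrivial if $\mathcal F\ne\emptyset,2^X$; it is increasing if $B\supseteq A\in\mathcal F$ implies $B\in\mathcal F$, and decreasing if $B\subseteq A\in\mathcal F$ implies $B\in\mathcal F$. For a decreasing family $\mathcal D\subseteq 2^X$ and a positive integer $k$, set $\mathcal D_{(k)}:=\{D_1\cup\cdots\cup D_k: D_i\in\mathcal D\}$ and $\mathcal D^{(k)}:=2^X\setminus\mathcal D_{(k)}$. For $S\subseteq X$ let $\langle S\rangle:=\{T\subseteq X: T\supseteq S\}$. A family $\mathcal G\subseteq 2^X$ covers $\mathcal I\subseteq 2^X$ if $\mathcal I\subseteq\bigcup_{S\in\mathcal G}\langle S\rangle$. A family $\mathcal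 I\subseteq 2^X$ is $p$-small if it has a cover $\mathcal G\subseteq 2^X$ with $\sum_{S\in\mathcal G}\mu_p(\langle S\rangle)\le 1/2$. (In particular the empty family is $p$-small.) The expectation threshold of an increasing family $\mathcal I$ is $q(\mathcal I)=\max\{p:\mathcal I\text{ is }p\text{-small}\}$. The $k$-threshold $p_k(\mathcal I)$ is the infimum of the set of $p\in[0,1]$ such that for every decreasing $\mathcal D\subseteq 2^X$ with $\mu_p(\mathcal D)\ge 1-\frac1{2k}$ we have $\mathcal D_{(k)}\cap\mathcal I\neq\emptyset$. *)

(* Defs.v *)
From mathcomp Require Import boolp classical_sets cardinality reals.
From mathcomp Require Import topology normedtype realfun.
(* imported last, so that set operations are those of finset by default *)
From mathcomp Require Import all_boot all_order all_algebra.

Set Implicit Arguments.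
Unset Strict Implicit.
Unset Printing Implicit Defensive.

Import Order.TTheory GRing.Theory Num.Theory numFieldNormedType.Exports.
Local Open Scope ring_scope.

Section Families.
Variable X : finType.
Implicit Types (F I G D : {set {set X}}) (A B S : {set X}) (k : nat).

Definition nontrivial F : Prop := F != set0 /\ F != [set: {set X}].

Definition increasing F : Prop :=
  forall A B, A \in F -> A \subset B -> B \in F.

Definition decreasing F : Prop :=
  forall A B, A \in F -> B \subset A -> B \in F.

(** D_(k) = { D_1 \cup ... \cup D_k : D_i \in D }; repetitions are allowed *)
Definition kunions D k : {set {set X}} :=
  [set \bigcup_(i < k) f i | f : {ffun 'I_k -> {set X}} in ffun_on D].

(** D^(k) = 2^X \ D_(k) *)
Definition non_kunions D k : {set {set X}} := ~: kunions D k.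

Definition upset S : {set {set X}} := [set T : {set X} | S \subset T].

Definition covers G I : Prop := I \subset \bigcup_(S in G) upset S.

End Families.

Section Thresholds.
Variables (R : realType) (X : finType).
Implicit Types (F I G D : {set {set X}}) (p : R) (k : nat).

Definition mu p F : R :=
  \sum_(A in F) p ^+ #|A| * (1 - p) ^+ #|~: A|.

Definition psmall p I : Prop :=
  exists G, covers G I /\ \sum_(S in G) mu p (upset S) <= 1 / 2.

Definition psmall_set I : set R :=
  [set p : R | 0 <= p <= 1 /\ psmall p I]%classic.

(** The supremum is a maximum whenever I is nontrivial and increasing, see
    [expectation_threshold_max] below. *)
Definition expectation_threshold I : R := sup (psmall_set I).

Definition kthreshold_set k I : set R :=
  [set p : R | 0 <= p <= 1 /\
    forall D, decreasing D -> 1 - 1 / (2 * k%:R) <= mu p D ->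
      kunions D k :&: I != set0]%classic.

(** The infimum of a nonempty set whenever 0 < k and I is nonempty, see
    [kthreshold_set1] below. *)
Definition kthreshold k I : R := inf (kthreshold_set k I).

Lemma continuous_bigsum (J : finType) (P : pred J) (f : J -> R -> R) :
  (forall j, continuous (f j)) -> continuous (fun p => \sum_(j | P j) f j p).
Proof.
move=> cf p; elim: (index_enum J) => [|j s IH].
  under eq_fun do rewrite big_nil.
  exact: cvg_cst.
under eq_fun do rewrite big_cons.
by case: ifP => _; [apply: cvgD => //; exact: cf|].
Qed.

Lemma continuous_mu F : continuous (fun p => mu p F).
Proof.
apply: continuous_bigsum => A p.
apply: cvgM; first exact: exprn_continuous.
apply: (@continuous_comp _ _ _ (fun q : R => 1 - q) (fun q : R => q ^+ _)).
  by apply: cvgB; [exact: cvg_cst|exact: cvg_id].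
exact: exprn_continuous.
Qed.

Lemma closed_psmall_set I : topology_structure.closed (psmall_set I).
Proof.
have -> : psmall_set I = (`[0%R, 1%R]%classic `&`
   \bigcup_(G in [set G | covers G I])
     ((fun p => \sum_(S in G) mu p (upset S)) @^-1`
        [set x | (x <= 1 / 2)%R]))%classic.
  apply/seteqP; split=> p /=.
    by move=> [p01 [G [GI le2]]]; split; [rewrite in_itv|exists G].
  by rewrite in_itv /= => -[p01 [G GI le2]]; split=> //; exists G.
apply: closedI; first exact: interval_closed.
apply: closed_bigcup => [|G _]; first exact: finite_finset.
apply: preimage_closed; last exact: closed_le.
move=> p _; exact: (continuous_bigsum (fun S => @continuous_mu (upset S))).
Qed.

Lemma psmall_set0 I : nontrivial I -> increasing I -> psmall_set I 0.
Proof.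
move=> [_ IT] incI; split; first by rewrite lexx ler01.
exists I; split.
  by apply/subsetP=> S SI; apply/bigcupP; exists S; rewrite ?inE.
rewrite big1 ?divr_ge0// => S SI; rewrite /mu big1// => A; rewrite inE => SA.
have [A0|] := eqVneq #|A| 0%N; last first.
  by rewrite -lt0n => A0; rewrite expr0n gtn_eqF// mul0r.
case/negP: IT; apply/eqP/setP => B; rewrite inE; apply: (incI S) => //.
by rewrite (subset_trans SA)// (eqP (_ : A == set0)) ?sub0set// -cards_eq0 A0.
Qed.

Lemma expectation_threshold_max I : nontrivial I -> increasing I ->
  psmall_set I (expectation_threshold I) /\
  forall p, psmall_set I p -> p <= expectation_threshold I.
Proof.
move=> ntI incI.
have S0 : (psmall_set I !=set0)%classic by exists 0; exact: psmall_set0.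
have ubS : has_ubound (psmall_set I) by exists 1 => p [/andP[]].
split; last by move=> p Sp; apply: ub_le_sup.
have := closure_sup S0 ubS; rewrite -(closure_id _).1//.
exact: closed_psmall_set.
Qed.

Lemma kthreshold_set1 k I : (0 < k)%N -> I != set0 -> kthreshold_set k I 1.
Proof.
move=> k0 /set0Pn[B BI]; split; first by rewrite ler01 lexx.
move=> D decD muD; apply/set0Pn; exists B; rewrite inE BI andbT.
have DT : [set: X] \in D.
  apply: contraT => DT; have : mu 1 D = 0.
    rewrite /mu big1// => A AD; rewrite subrr expr0n cards_eq0.
    suff /negPf -> : (~: A) != set0 by rewrite mulr0.
    by apply: contraNneq DT => A0; rewrite -setC0 -A0 setCK.
  move=> mu0; move: muD; rewrite mu0 subr_le0 leNgt => /negP[].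
  by rewrite div1r invf_lt1 ?mulr_gt0 ?ltr0n// -natrM ltr1n -[2%N]muln1 leq_mul.
apply/imsetP; exists [ffun=> B].
  by apply/ffun_onP => i; rewrite ffunE; apply: decD DT _; apply: subsetT.
apply/setP=> x; apply/idP/bigcupP => [xB|[i _]]; last by rewrite ffunE.
by exists (Ordinal k0); rewrite ?ffunE.
Qed.

End Thresholds.

(* Main.v *)
(** A decreasing family has [mu p]-measure nonincreasing in [p]: a [p * r]-random
    set is a [p]-random set thinned with retention probability [r]. Hence
    p-smallness is inherited by smaller p and the set defining the k-threshold is
    upward closed.

    Given the smallness of all D^(k), if p > L q(I) then I is not (p/L)-small, so
    it cannot lie inside any D^(k): it meets every D_(k), and p_k(I) <= p. Passing
    from k to k + 1 only weakens the smallness assertion, so k >= 2 is no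
    restriction. Conversely, apply the threshold inequality to I = D^(k): since I
    misses D_(k), p <= p_k(I) <= L q(I), whence I is (p/L)-small. *)

Require Import Defs.
From mathcomp Require Import all_boot all_order all_algebra reals.
Local Open Scope ring_scope.

Set Implicit Arguments.
Unset Strict Implicit.
Unset Printing Implicit Defensive.

Import Order.TTheory GRing.Theory Num.Theory.

Section MonotoneMeasure.
Variables (R : realType) (X : finType).
Implicit Types (p q r : R) (A C S : {set X}) (D I : {set {set X}}).

(** The product over points lets sums over all subsets factor through [bigA_distr]. *)
Let weight p A : R := \prod_x (if x \in A then p else 1 - p).

Let weightE p A : p ^+ #|A| * (1 - p) ^+ #|~: A| = weight p A.
Proof.
rewrite /weight (bigID (mem A))/=; congr (_ * _).
  by rewrite -prodr_const; apply: eq_bigr => x ->.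
rewrite -prodr_const; apply: eq_big => [x|x]; rewrite inE// => /negPf -> //.
Qed.

Lemma mu_setT p : mu p [set: {set X}] = 1.
Proof.
rewrite /mu big_mkcond/=.
under eq_bigr do rewrite inE weightE.
by rewrite -bigA_distr big1// => x _ /=; rewrite subrKC.
Qed.

Lemma mu_setC p D : mu p (~: D) = 1 - mu p D.
Proof.
apply/eqP; rewrite eq_sym subr_eq -(mu_setT p) addrC /mu (bigID (mem D))/=.
by apply/eqP; congr (_ + _); apply: eq_bigl => A; rewrite !inE.
Qed.

(* The law of a subset of [A] keeping each point independently with
   probability [r]; averaged over [A] of law [mu p] it gives [mu (p * r)]. *)
Let thinning r A C : R :=
  \prod_x (if x \in C then (if x \in A then r else 0)
           else (if x \in A then 1 - r else 1)).

Let thinning_ge0 r A C : 0 <= r <= 1 -> 0 <= thinning r A C.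
Proof.
move=> /andP[r0 r1]; apply: prodr_ge0 => x _.
by case: ifP => _; case: ifP => _ //; rewrite subr_ge0.
Qed.

Let thinning_sum r A : \sum_C thinning r A C = 1.
Proof.
rewrite -bigA_distr big1// => x _ /=.
by case: ifP => _; rewrite ?subrKC ?add0r.
Qed.

Let thinning_eq0 r A C : ~~ (C \subset A) -> thinning r A C = 0.
Proof.
move=> /subsetPn[x xC /negPf xA].
by rewrite /thinning (bigD1 x)//= xC xA mul0r.
Qed.

(** The sum factors over points: a point of [C] contributes [p * r], any other point
    [p * (1 - r) + (1 - p) = 1 - p * r]. *)
Let weight_thinning p r C : \sum_A weight p A * thinning r A C = weight (p * r) C.
Proof.
transitivity (\sum_(A : {set X}) \prod_(x : X) (if x \in A
    then p * (if x \in C then r else 1 - r)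
    else (1 - p) * (if x \in C then 0 else 1))).
  apply: eq_bigr => A _; rewrite -big_split/=; apply: eq_bigr => x _.
  by case: ifP => _; case: ifP.
rewrite -bigA_distr; apply: eq_bigr => x _ /=; case: ifP => _.
  by rewrite mulr0 addr0.
by rewrite mulr1 mulrBr mulr1 addrC addrA subrK.
Qed.

Lemma le_mu_decreasing D p q : decreasing D -> 0 <= q <= p -> p <= 1 ->
  mu p D <= mu q D.
Proof.
move=> decD /andP[q0 qp] p1.
(* The retention probability will be [q / p], so [p = 0] is set apart. *)
have [p0|p0] := eqVneq p 0.
  have -> // : q = p by apply/eqP; rewrite eq_le qp p0 q0.
have pgt0 : 0 < p by rewrite lt0r p0 (le_trans q0).
have r01 : 0 <= q / p <= 1 by rewrite divr_ge0 ?(ltW pgt0)//= ler_pdivrMr ?mul1r.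
have -> : mu q D = \sum_A weight p A * \sum_(C in D) thinning (q / p) A C.
  under eq_bigr do rewrite mulr_sumr.
  rewrite exchange_big/=; apply: eq_bigr => C _.
  by rewrite weightE weight_thinning mulrCA divff// mulr1.
have w0 A : 0 <= weight p A.
  by apply: prodr_ge0 => x _; case: ifP => _; rewrite ?subr_ge0// ltW.
(* Sets [A] outside [D] contribute a nonnegative amount. For [A] in [D] every subset of [A] stays in
   [D], so the inner sum is the full mass 1. *)
rewrite [leRHS](bigID (mem D))/= -[leLHS]addr0; apply: lerD; last first.
  apply: sumr_ge0 => A _; rewrite mulr_ge0// sumr_ge0// => C _.
  exact: thinning_ge0.
rewrite le_eqVlt /mu; apply/orP; left; apply/eqP; apply: eq_bigr => A AD.
rewrite weightE -[LHS]mulr1 -(thinning_sum (q / p) A) (bigID (mem D))/=.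
rewrite [X in _ * (_ + X)]big1 ?addr0// => C CD; apply: thinning_eq0.
by apply: contra CD; exact: decD.
Qed.

(** The complement of an up-set is decreasing. *)
Lemma le_mu_upset S p q : 0 <= q <= p -> p <= 1 ->
  mu q (upset S) <= mu p (upset S).
Proof.
move=> qp p1; rewrite -[upset S]setCK !(mu_setC _ (~: _)) lerD2l lerN2.
apply: le_mu_decreasing => // A B; rewrite !inE => SA BA.
by apply: contra SA => /subset_trans; apply.
Qed.

Lemma psmall_le I p q : 0 <= q <= p -> p <= 1 -> psmall p I -> psmall q I.
Proof.
move=> qp p1 [G [GI le2]]; exists G; split=> //; apply: le_trans le2.
by apply: ler_sum => S _; exact: le_mu_upset.
Qed.

End MonotoneMeasure.

Lemma psmall_sub (R : realType) (X : finType) (p : R) (I J : {set {set X}}) :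
  I \subset J -> psmall p J -> psmall p I.
Proof. by move=> IJ [G [GJ le2]]; exists G; split=> //; exact: subset_trans GJ. Qed.

Section KUnions.
Variable X : finType.
Implicit Types (D : {set {set X}}) (B : {set X}) (k : nat).

Lemma kunionsP D k B :
  reflect (exists2 f : 'I_k -> {set X}, (forall i, f i \in D) &
             B = \bigcup_(i < k) f i) (B \in kunions D k).
Proof.
apply: (iffP imsetP) => [[f /ffun_onP fD ->]|[f fD ->]]; first by exists f.
exists [ffun i => f i]; first by apply/ffun_onP => i; rewrite ffunE.
by apply: eq_bigr => i _; rewrite ffunE.
Qed.

Lemma decreasing_set0 D : D != set0 -> decreasing D -> set0 \in D.
Proof. by move=> /set0Pn[A AD] decD; exact: decD AD (sub0set A). Qed.

Lemma kunions_subS D k : set0 \in D -> kunions D k \subset kunions D k.+1.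
Proof.
move=> D0; apply/subsetP => B /kunionsP[f fD ->]; apply/kunionsP.
(* The [k] sets are padded with the empty set at the last index. *)
exists (fun i => oapp f set0 (unlift ord_max i)).
  by move=> i; case: unliftP => [j _|_ //]; exact: fD.
rewrite big_ord_recr/= unlift_none/= setU0; apply: eq_bigr => i _.
rewrite (_ : widen_ord _ i = lift ord_max i) ?liftK//.
by apply/val_inj; rewrite /= /bump leqNgt ltn_ord.
Qed.

Lemma kunions_set0 D k : set0 \in D -> set0 \in kunions D k.
Proof. by move=> D0; apply/kunionsP; exists (fun=> set0) => //; rewrite big1. Qed.

Lemma kunions_setT k : (0 < k)%N -> kunions [set: {set X}] k = setT.
Proof.
move=> k0; apply/setP => B; rewrite !inE; apply/kunionsP.
exists (fun=> B) => [i|]; first by rewrite inE.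
apply/setP => x; apply/idP/bigcupP => [xB|[i _ //]].
by exists (Ordinal k0).
Qed.

(** To shrink a union to [B], intersect each of its members with [B]. *)
Lemma decreasing_kunions D k : decreasing D -> decreasing (kunions D k).
Proof.
move=> decD A B /kunionsP[f fD ->] BA; apply/kunionsP.
exists (fun i => B :&: f i) => [i|]; first by apply: decD (fD i) _; exact: subsetIr.
by rewrite -big_distrr/=; apply/esym/setIidPl.
Qed.

Lemma increasing_non_kunions D k : decreasing D -> increasing (non_kunions D k).
Proof.
move=> decD A B; rewrite !inE => AD AB; apply: contra AD => BD.
exact: decreasing_kunions BD AB.
Qed.

End KUnions.

Lemma kthreshold_set_le (R : realType) (X : finType) (I : {set {set X}}) k (p q : R) :
  q <= p <= 1 -> kthreshold_set k I q -> kthreshold_set k I p.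
Proof.
move=> /andP[qp p1] [/andP[q0 _] qI]; split; first by rewrite p1 (le_trans q0).
move=> D decD muD; apply: qI => //; apply: le_trans muD _.
by apply: le_mu_decreasing; rewrite ?q0.
Qed.

Lemma kthreshold_le_of_psmall (R : realType) (k : nat) (L : R) : (0 < k)%N -> 1 <= L ->
  (forall (p : R), 0 < p < 1 ->
   forall (X : finType) (D : {set {set X}}),
     nontrivial D -> decreasing D ->
     1 - 1 / (2 * k%:R) <= mu p D ->
     psmall (p / L) (non_kunions D k)) ->
  forall (X : finType) (I : {set {set X}}),
    nontrivial I -> increasing I ->
    kthreshold R k I <= L * expectation_threshold R I.
Proof.
move=> k0 L1 smallD X I ntI incI.
have L0 : 0 < L by exact: lt_le_trans L1.
have [[/andP[q0 _] _] qmax] := expectation_threshold_max R ntI incI.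
have I0 := ntI.1.
set q := expectation_threshold R I in q0 qmax *.
have lbI : classical_sets.has_lbound (kthreshold_set k I : classical_sets.set R).
  by exists 0 => p [/andP[]].
have kthr_le p : kthreshold_set k I p -> kthreshold R k I <= p by exact: ge_inf.
have [Lq1|Lq1] := leP 1 (L * q).
  by apply: le_trans Lq1; apply: kthr_le; exact: kthreshold_set1.
(* The slack [e] gives [q < p / L] strictly for [p = L * q + e], which maximality of [q]
   requires. *)
apply/ler_addgt0Pr => e e0.
have [|pe1] := leP 1 (L * q + e).
  by apply: le_trans; apply: kthr_le; exact: kthreshold_set1.
set p := L * q + e in pe1 *.
have p0 : 0 < p by rewrite ltr_wpDl// mulr_ge0// ltW.
apply: kthr_le; split=> [|D decD muD]; first by rewrite !ltW.
have half : 1 / (2 * k%:R) < 1 :> R.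
  by rewrite div1r invf_lt1 ?mulr_gt0 ?ltr0n// -natrM ltr1n -[2%N]muln1 leq_mul.
have D0 : D != set0.
  apply: contraTneq muD => ->; rewrite /mu big_set0 subr_le0 -ltNge//.
have [DT|DT] := eqVneq D setT; first by rewrite DT kunions_setT// setTI.
(* An empty intersection would put [I] inside [non_kunions D k], making it [p / L]-small. *)
apply: contra_ltN (_ : q < p / L) => [/eqP DI|]; last first.
  by rewrite ltr_pdivlMr// mulrC ltrDl.
apply: qmax; split.
  by rewrite divr_ge0 ?(ltW p0) ?(ltW L0)// ler_pdivrMr// mul1r (le_trans (ltW pe1)).
apply: psmall_sub (smallD p _ X D _ decD muD) => //; last by rewrite p0.
by rewrite -disjoints_subset -setI_eq0 setIC DI.
Qed.

Theorem proposition1p5 (R : realType) :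
  (exists (k : nat) (L : R), (0 < k)%N /\ 1 <= L /\
     forall (p : R), 0 < p < 1 ->
     forall (X : finType) (D : {set {set X}}),
       nontrivial D -> decreasing D ->
       1 - 1 / (2 * k%:R) <= mu p D ->
       psmall (p / L) (non_kunions D k))
  <->
  (exists (k : nat) (L : R), (2 <= k)%N /\ 1 <= L /\
     forall (X : finType) (I : {set {set X}}),
       nontrivial I -> increasing I ->
       kthreshold R k I <= L * expectation_threshold R I).
Proof.
split=> -[k [L [k0 [L1 H]]]].
  exists k.+1, L; split=> //; split=> //.
  apply: kthreshold_le_of_psmall => // p p01 X D ntD decD muD.
  have D0 := decreasing_set0 ntD.1 decD.
  apply: psmall_sub (H p p01 X D ntD decD _).
    by rewrite setCS kunions_subS.
  (* The measure bound for [k.+1] is at least the one for [k]. *)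
  apply: le_trans muD; rewrite lerD2l lerN2 !div1r lef_pV2 ?posrE ?mulr_gt0 ?ltr0n//.
  by rewrite ler_pM2l// ler_nat.
have kgt0 : (0 < k)%N by exact: ltnW.
exists k, L; split=> //; split=> // p /andP[p0 p1] X D ntD decD muD.
have L0 : 0 < L by exact: lt_le_trans L1.
set I := non_kunions D k.
(* The threshold inequality needs [I] nontrivial; an empty [I] is covered by the empty family. *)
have [->|I0] := eqVneq I set0.
  by exists set0; split; [exact: sub0set|rewrite big_set0 divr_ge0].
have ntI : nontrivial I.
  split=> //; apply/eqP => /setP/(_ set0).
  by rewrite !inE kunions_set0//; exact: decreasing_set0 ntD.1 decD.
have incI : increasing I by exact: increasing_non_kunions.
have [[/andP[_ q1] qsmall] _] := expectation_threshold_max R ntI incI.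
apply: psmall_le qsmall => //.
rewrite divr_ge0 ?(ltW p0) ?(ltW L0)//= ler_pdivrMr// mulrC.
apply: le_trans (H X I ntI incI); apply: lb_le_inf.
  by exists 1; exact: kthreshold_set1.
(* Upward closure would carry [r < p] to [p] itself, where [D] is a counterexample. *)
move=> r rI; rewrite leNgt; apply/negP => rp.
have [_ /(_ D decD muD)] : kthreshold_set k I p.
  by apply: kthreshold_set_le rI; rewrite !ltW.
by rewrite /I /non_kunions setICr eqxx.
Qed.
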